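(* Not all skew lattices in rings are strictly categorical. If $a>b,b'>c$, then $b=b'$ or else $b,b'$ belong to distinct cosets. A counterexample to strict categoricity is given by the four matrices in $M_4(F)$ $$a=\begin{bmatrix}1&0&0&0\\0&1&0&0\\0&0&1&0\\0&0&0&0\end{bmatrix},\quad b=\begin{bmatrix}1&0&0&0\\0&1&0&0\\0&0&0&0\\0&0&0&0\end{bmatrix},\quad b'=\begin{bmatrix}1&0&0&0\\0&1&1&0\\0&0&0&0\\0&0&0&0\end{bmatrix},\quad c=\begin{bmatrix}1&0&0&0\\0&0&0&0\\0&0&0&0\\0&0&0&0\end{bmatrix}.$$ They satisfy $bb'=b'$, $b'b=b$, $ba=b$, $b'a=b'$, $cb=c$, $cb'=c$. In terms of the block entries described in the context, the last four of these relations imply $$a_{14}+b_{13}a_{34}=b_{14},\quad a_{24}+b_{23}a_{34}=b_{24},\quad b_{13}+c_{12}b_{23}=c_{13},\quad b_{14}+c_{12}b_{24}=c_{14},$$ together with the same four equations with $b'_{ij}$ in place of $b_{ij}$; in the example all these entries are null with the exception of $b'_{23}=1$. The set $\{a,b,b',c\}$ is a skew lattice in the ring $M_4(F)$ having the admissible Hasse diagram of the four-element right-handed skew lattice $\{1,2,3,0\}$ defined in the context, with $a=1$, $b=2$, $b'=3$, $c=0$: its $\mathcal D$-classes are $\{a\}>\{b,b'\}>\{c\}$, and $a>b>c$ and $a>b'>c$ with $b\neq b'$. It is not strictly categorical.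
   Context: A skew lattice is a set $S$ with associative idempotent binary operations $\wedge,\vee$ satisfying $x\wedge(x\vee y)=x=(y\vee x)\wedge x$ and the duals $x\vee(x\wedge y)=x=(y\wedge x)\vee x$. For a ring $R$, $E(R)$ is the set of idempotents of $R$. Put $x\circ y=x+y-xy$ and $x\nabla y=(x\circ y)^2$. A skew lattice in the ring $R$ is a set $S\subseteq E(R)$ closed under multiplication and $\nabla$ such that $S$ with $x\wedge y=xy$ and $x\vee y=x\nabla y$ is a skew lattice; in the right-handed case $\nabla$ reduces to $\circ$. $M_4(F)$ is the ring of $4\times4$ matrices over a field $F$. Natural partial order: $x\geq y$ iff $x\wedge y=y=y\wedge x$. Natural preorder: $x\succeq y$ iff $y\wedge x\wedge y=y$. $x\,\mathcal D\,y$ iff $x\succeq y$ and $y\succeq x$; $\mathcal D$ is a congruence and $S/\mathcal D$ is a lattice; for $\mathcal D$-classes, $A>B$ refers to the order in $S/\mathcal D$. $S$ is right-handed if $\mathcal R=\mathcal D$, where $x\,\mathcal R\,y$ iff $x\wedge y=y$ and $y\wedge x=x$. An admissible Hasse diagram of $S$ is a Hasse diagram for the natural partial order together with an indication of all $\mathcal D$-congruent elements. The four-element right-handed skew lattice $\{1,2,3,0\}$ has top $1$ and bottom $0$ (so $1\wedge x=x=x\wedge 1$, $0\wedge x=0=x\wedge 0$, $1\vee x=1=x\vee 1$, $0\vee x=x=x\vee 0$) and $2\wedge3=3$, $3\wedge2=2$, $2\vee3=2$, $3\vee2=3$. Its diagram has $1>2>0$, $1>3>0$ and $2\,\mathcal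 D\,3$. Block form: for matrices $a,b,c$ in $\mathcal D$-classes $A>B>C$ respectively, $$a=\begin{bmatrix}I&0&0&a_{14}\\0&I&0&a_{24}\\0&0&I&a_{34}\\0&0&0&0\end{bmatrix},\quad b=\begin{bmatrix}I&0&b_{13}&b_{14}\\0&I&b_{23}&b_{24}\\0&0&0&0\\0&0&0&0\end{bmatrix},\quad c=\begin{bmatrix}I&c_{12}&c_{13}&c_{14}\\0&0&0&0\\0&0&0&0\\0&0&0&0\end{bmatrix},$$ and $b'$ has the same form as $b$ with entries $b'_{ij}$. For $\mathcal D$-classes $A>B$, the cosets of $A$ in $B$ are the sets $A\wedge b\wedge A$ ($b\in B$) and the cosets of $B$ in $A$ are the sets $B\vee a\vee B$ ($a\in A$). For $a\in A$, $b\in B$ the coset bijection $\varphi_{a,b}:B\vee a\vee B\to A\wedge b\wedge A$ is the bijection with $\varphi_{a,b}(x)=y$ iff $x\geq y$; coset bijections are regarded as partial functions from $A$ to $B$. A skew lattice is categorical if nonempty composites of coset bijections are coset bijections. A categorical skew lattice is strictly categorical if the compositions of coset bijections between comparable $\mathcal D$-classes $A>B>C$ (one from $A$ to $B$ followed by one from $B$ to $C$) are never empty. *)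

(* Defs.v *)
From HB Require Import structures.
From mathcomp Require Import all_boot all_algebra.
From mathcomp Require Import boolp classical_sets functions.

Set Implicit Arguments.
Unset Strict Implicit.
Unset Printing Implicit Defensive.

Import GRing.Theory.

Local Open Scope classical_set_scope.
Local Open Scope ring_scope.

(* A set with two operations defined on an ambient type: subsets of a ring are
   thus handled without subtypes, and every notion below is relativized to the
   underlying set. *)
Record skew_ops (T : Type) := SkewOps {
  sdom : set T;
  smeet : T -> T -> T;
  sjoin : T -> T -> T
}.

Definition is_skew_lattice (T : Type) (L : skew_ops T) : Prop :=
  let S := sdom L in let m := smeet L in let j := sjoin L in
  [/\ (forall x y, S x -> S y -> S (m x y) /\ S (j x y)),
      (forall x y z, S x -> S y -> S z ->
         m x (m y z) = m (m x y) z /\ j x (j y z) = j (j x y) z),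
      (forall x, S x -> m x x = x /\ j x x = x),
      (forall x y, S x -> S y -> m x (j x y) = x /\ m (j y x) x = x) &
      (forall x y, S x -> S y -> j x (m x y) = x /\ j (m y x) x = x)].

Section Relations.
Context {T : Type} (L : skew_ops T).

Definition nord_ge (x y : T) : Prop := smeet L x y = y /\ smeet L y x = y.

Definition nord_gt (x y : T) : Prop := nord_ge x y /\ x <> y.

Definition pre_ge (x y : T) : Prop := smeet L (smeet L y x) y = y.

Definition relD (x y : T) : Prop := pre_ge x y /\ pre_ge y x.

Definition relR (x y : T) : Prop := smeet L x y = y /\ smeet L y x = x.

Definition right_handed : Prop :=
  forall x y, sdom L x -> sdom L y -> (relR x y <-> relD x y).

Definition is_Dclass (A : set T) : Prop :=
  exists2 x, sdom L x & A = [set y | sdom L y /\ relD x y].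

(* Strict order of the quotient lattice: [A] and [B] are distinct, and their
   meet, which is the class of any [a /\ b], is [B]. *)
Definition Dclass_gt (A B : set T) : Prop :=
  [/\ is_Dclass A, is_Dclass B, A <> B &
      forall a b, A a -> B b -> B (smeet L a b)].

(* A /\ b /\ A *)
Definition meet_coset (A : set T) (b : T) : set T :=
  [set z | exists x y, [/\ A x, A y & z = smeet L (smeet L x b) y]].

(* B \/ a \/ B *)
Definition join_coset (B : set T) (a : T) : set T :=
  [set z | exists x y, [/\ B x, B y & z = sjoin L (sjoin L x a) y]].

(* For A > B: the cosets of A in B, and the cosets of B in A. *)
Definition cosets_in_lower (A B : set T) : set (set T) :=
  [set X | exists2 b, B b & X = meet_coset A b].

Definition cosets_in_upper (A B : set T) : set (set T) :=
  [set X | exists2 a, A a & X = join_coset B a].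

Definition in_distinct_cosets (K : set (set T)) (x y : T) : Prop :=
  [/\ exists2 X, K X & X x,
      exists2 Y, K Y & Y y &
      forall X Y, K X -> K Y -> X x -> Y y -> X <> Y].

(* Partial functions are represented by their graphs. *)
Definition phi (A B : set T) (a b : T) : T -> T -> Prop :=
  fun x y => [/\ join_coset B a x, meet_coset A b y & nord_ge x y].

Definition coset_bijection (A B : set T) (f : T -> T -> Prop) : Prop :=
  exists a b, [/\ A a, B b & f = phi A B a b].

Definition rel_comp (f g : T -> T -> Prop) : T -> T -> Prop :=
  fun x z => exists2 y, f x y & g y z.

Definition rel_nonempty (f : T -> T -> Prop) : Prop := exists x y, f x y.

Definition categorical : Prop :=
  forall A B C f g, Dclass_gt A B -> Dclass_gt B C ->
    coset_bijection A B f -> coset_bijection B C g ->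
    rel_nonempty (rel_comp f g) -> coset_bijection A C (rel_comp f g).

Definition strictly_categorical : Prop :=
  categorical /\
  forall A B C f g, Dclass_gt A B -> Dclass_gt B C ->
    coset_bijection A B f -> coset_bijection B C g ->
    rel_nonempty (rel_comp f g).

(* Edges of the Hasse diagram of the natural partial order. *)
Definition covers (x y : T) : Prop :=
  [/\ sdom L x, sdom L y, nord_gt x y &
      ~ exists z, [/\ sdom L z, nord_gt x z & nord_gt z y]].

End Relations.

(* [f] identifies the admissible Hasse diagrams of [L1] and [L2]. *)
Definition admissible_diagram_iso (T1 T2 : Type) (L1 : skew_ops T1)
    (L2 : skew_ops T2) (f : T1 -> T2) : Prop :=
  set_bij (sdom L1) (sdom L2) f /\
  forall x y, sdom L1 x -> sdom L1 y ->
    (covers L1 x y <-> covers L2 (f x) (f y)) /\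
    (relD L1 x y <-> relD L2 (f x) (f y)).

Definition circ (R : pzRingType) (x y : R) : R := x + y - x * y.

Definition nabla (R : pzRingType) (x y : R) : R := circ x y ^+ 2.

Definition ring_ops (R : pzRingType) (S : set R) : skew_ops R :=
  SkewOps S (fun x y => x * y) (@nabla R).

Definition skew_lattice_in_ring (R : pzRingType) (S : set R) : Prop :=
  (forall x, S x -> x * x = x) /\ is_skew_lattice (ring_ops S).

Inductive four := el1 | el2 | el3 | el0.

Definition four_meet (x y : four) : four :=
  match x, y with
  | el1, _ => y
  | _, el1 => x
  | el0, _ | _, el0 => el0
  | _, _ => y
  end.

Definition four_join (x y : four) : four :=
  match x, y with
  | el0, _ => y
  | _, el0 => x
  | el1, _ | _, el1 => el1
  | _, _ => x
  end.

Definition four_ops : skew_ops four := SkewOps setT four_meet four_join.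

Lemma four_skew_lattice : is_skew_lattice four_ops.
Proof.
split=> [[] []|[] [] []|[]|[] []|[] []] //=.
Qed.

Lemma four_right_handed : right_handed four_ops.
Proof. by case; case=> _ _; rewrite /relD /relR /pre_ge /=; split; case. Qed.

Section Blocks.
Context {F : fieldType} {n1 n2 n3 n4 : nat}.
Local Notation N := (n1 + (n2 + (n3 + n4)))%N.

Definition blockA (a14 : 'M[F]_(n1, n4)) (a24 : 'M[F]_(n2, n4))
    (a34 : 'M[F]_(n3, n4)) : 'M[F]_N :=
  col_mx (row_mx 1%:M (row_mx 0 (row_mx 0 a14)))
 (col_mx (row_mx 0 (row_mx 1%:M (row_mx 0 a24)))
 (col_mx (row_mx 0 (row_mx 0 (row_mx 1%:M a34)))
         (0 : 'M_(n4, N)))).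

Definition blockB (b13 : 'M[F]_(n1, n3)) (b14 : 'M[F]_(n1, n4))
    (b23 : 'M[F]_(n2, n3)) (b24 : 'M[F]_(n2, n4)) : 'M[F]_N :=
  col_mx (row_mx 1%:M (row_mx 0 (row_mx b13 b14)))
 (col_mx (row_mx 0 (row_mx 1%:M (row_mx b23 b24)))
         (0 : 'M_(n3 + n4, N))).

Definition blockC (c12 : 'M[F]_(n1, n2)) (c13 : 'M[F]_(n1, n3))
    (c14 : 'M[F]_(n1, n4)) : 'M[F]_N :=
  col_mx (row_mx 1%:M (row_mx c12 (row_mx c13 c14)))
         (0 : 'M_(n2 + (n3 + n4), N)).

End Blocks.

Definition mx4 (F : fieldType) (rows : seq (seq F)) : 'M[F]_4 :=
  \matrix_(i < 4, j < 4) nth 0 (nth [::] rows i) j.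

Definition exa (F : fieldType) : 'M[F]_4 :=
  mx4 [:: [:: 1; 0; 0; 0];
          [:: 0; 1; 0; 0];
          [:: 0; 0; 1; 0];
          [:: 0; 0; 0; 0]].

Definition exb (F : fieldType) : 'M[F]_4 :=
  mx4 [:: [:: 1; 0; 0; 0];
          [:: 0; 1; 0; 0];
          [:: 0; 0; 0; 0];
          [:: 0; 0; 0; 0]].

Definition exb' (F : fieldType) : 'M[F]_4 :=
  mx4 [:: [:: 1; 0; 0; 0];
          [:: 0; 1; 1; 0];
          [:: 0; 0; 0; 0];
          [:: 0; 0; 0; 0]].

Definition exc (F : fieldType) : 'M[F]_4 :=
  mx4 [:: [:: 1; 0; 0; 0];
          [:: 0; 0; 0; 0];
          [:: 0; 0; 0; 0];
          [:: 0; 0; 0; 0]].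

Definition exSet (F : fieldType) : set 'M[F]_4 :=
  [set exa F; exb F; exb' F; exc F].
Arguments exSet F : clear implicits.

(* Main.v *)
Require Import Defs.
From mathcomp Require Import all_boot all_algebra.
From mathcomp Require Import boolp classical_sets functions.

Set Implicit Arguments.
Unset Strict Implicit.
Unset Printing Implicit Defensive.

Import GRing.Theory.

Local Open Scope classical_set_scope.
Local Open Scope ring_scope.

(** If [x] and [a] lie in the D-class [A > B] and [b] in [B], then [a ∨ b] lies in
    [A] and [(a ∨ b) ∧ b = b], so [a ∧ x ∧ b = a ∧ (x ∧ (a ∨ b)) ∧ b = a ∧ b],
    [A] being a rectangular band; dually on the right. Hence conjugation by [a] is
    constant on each coset [A ∧ b0 ∧ A], while it fixes every element below [a]: a
    coset contains only one element below [a]. The statement on the cosets of [C]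
    in [B] is the same one in the lattice with meet and join exchanged.

    In the example, the four matrices multiply and [∇]-multiply as the abstract
    four-element skew lattice, to which all order-theoretic questions are
    transported. *)

(** * Bands: transitivity of the natural preorder and the rectangular identity *)

Section Band.
Variables (T : Type) (S : set T) (m : T -> T -> T).
Hypothesis mS : forall x y, S x -> S y -> S (m x y).
Hypothesis mA : forall x y z, S x -> S y -> S z -> m x (m y z) = m (m x y) z.
Hypothesis mI : forall x, S x -> m x x = x.

(** Transitivity of the natural preorder. For [v = x y z], the hypothesis [y x y = y] gives
    [y v = y z], and idempotence of [v] turns this into [(y z) v = y z]. Multiplying by [z] on the
    left yields [z x y z = z], so [z] is fixed by left multiplication by [z x]. *)
Lemma band_pre_ge_trans x y z : S x -> S y -> S z ->
  m (m y x) y = y -> m (m z y) z = z -> m (m z x) z = z.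
Proof.
move=> Sx Sy Sz yxy zyz.
have Sw : S (m y z) by apply: mS.
have Sv : S (m x (m y z)) by apply: mS.
have Syx : S (m y x) by apply: mS.
have Szx : S (m z x) by apply: mS.
have Szy : S (m z y) by apply: mS.
have yv : m y (m x (m y z)) = m y z by rewrite !mA // yxy.
have wv : m (m y z) (m x (m y z)) = m y z.
  by rewrite -{1}yv -mA // mI.
have tyz : m (m z x) (m y z) = z.
  have := congr1 (m z) wv.
  by rewrite [RHS]mA // zyz [LHS]mA // (mA Sz Sy Sz) zyz mA.
by rewrite -{2}tyz mA // mI.
Qed.

(** Everything rests on [z x y z = z]: then [x z = x (z x y z) = x y z], because [x z x = x]. *)
Lemma rectangular_mulKm x y z : S x -> S y -> S z ->
  m (m x y) x = x -> m (m y z) y = y -> m (m x z) x = x -> m (m z x) z = z ->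
  m (m x y) z = m x z.
Proof.
move=> Sx Sy Sz xyx yzy xzx zxz.
have [Sxy Syz Szx Sxz Syx] :
  [/\ S (m x y), S (m y z), S (m z x), S (m x z) & S (m y x)].
  by split; apply: mS.
have St : S (m (m z x) (m y z)) by apply: mS.
have Syxz : S (m y (m x z)) by apply: mS.
have tz : m (m (m z x) (m y z)) (m y (m x z)) = z.
  rewrite -[m (m (m z x) _) _]mA // [m (m y z) _]mA // yzy.
  rewrite -[m (m z x) _]mA // [m y _]mA // [m x _]mA // [m x (m y x)]mA //.
  by rewrite xyx mA.
(* Write [t = z x y z] and [w = y x z]. From [t w = z] and [t z = t] follows
   [t = t z = t t w = t w = z]. *)
have tE : m (m z x) (m y z) = z.
  have tz' : m (m (m z x) (m y z)) z = m (m z x) (m y z).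
    by rewrite -[m _ z]mA // -[m (m y z) z]mA // mI.
  move: (m (m z x) (m y z)) St tz tz' => t St tw tz'; rewrite -tz'.
  by have := congr1 (m t) tw; rewrite mA // mI // tw => <-.
by rewrite -{2}tE [RHS]mA // [m x (m z x)]mA // xzx mA.
Qed.

End Band.

(** * Skew lattices: duality, the natural preorder, D-classes and cosets *)

Definition dual_ops (T : Type) (L : skew_ops T) : skew_ops T :=
  SkewOps (sdom L) (sjoin L) (smeet L).

Lemma dual_skew_lattice (T : Type) (L : skew_ops T) :
  is_skew_lattice L -> is_skew_lattice (dual_ops L).
Proof.
case=> cl As idem ab1 ab2; split=> //=.
- by move=> x y Sx Sy; case: (cl x y Sx Sy).
- by move=> x y z Sx Sy Sz; case: (As x y z Sx Sy Sz).
- by move=> x Sx; case: (idem x Sx).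
Qed.

Section SkewLattice.
Variables (T : Type) (L : skew_ops T).
Hypothesis slL : is_skew_lattice L.
Local Notation S := (sdom L).
Local Notation "x ∧ y" := (smeet L x y) (at level 40, left associativity).
Local Notation "x ∨ y" := (sjoin L x y) (at level 40, left associativity).

Lemma smeet_closed x y : S x -> S y -> S (x ∧ y).
Proof. by case: slL => cl _ _ _ _ Sx Sy; case: (cl x y). Qed.

Lemma sjoin_closed x y : S x -> S y -> S (x ∨ y).
Proof. by case: slL => cl _ _ _ _ Sx Sy; case: (cl x y). Qed.

Lemma smeetA x y z : S x -> S y -> S z -> x ∧ (y ∧ z) = x ∧ y ∧ z.
Proof. by case: slL => _ h _ _ _ Sx Sy Sz; case: (h x y z). Qed.

Lemma sjoinA x y z : S x -> S y -> S z -> x ∨ (y ∨ z) = x ∨ y ∨ z.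
Proof. by case: slL => _ h _ _ _ Sx Sy Sz; case: (h x y z). Qed.

Lemma smeetxx x : S x -> x ∧ x = x.
Proof. by case: slL => _ _ h _ _ Sx; case: (h x). Qed.

Lemma sjoinxx x : S x -> x ∨ x = x.
Proof. by case: slL => _ _ h _ _ Sx; case: (h x). Qed.

Lemma smeetKU x y : S x -> S y -> x ∧ (x ∨ y) = x.
Proof. by case: slL => _ _ _ h _ Sx Sy; case: (h x y). Qed.

Lemma smeetUK x y : S x -> S y -> (y ∨ x) ∧ x = x.
Proof. by case: slL => _ _ _ h _ Sx Sy; case: (h x y). Qed.

Lemma sjoinKI x y : S x -> S y -> x ∨ (x ∧ y) = x.
Proof. by case: slL => _ _ _ _ h Sx Sy; case: (h x y). Qed.

Lemma sjoinIK x y : S x -> S y -> (y ∧ x) ∨ x = x.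
Proof. by case: slL => _ _ _ _ h Sx Sy; case: (h x y). Qed.

(** Reads the preorder through the join. Absorption gives [b ∨ (a ∧ b) = a ∧ b], hence
    [a ∨ b ∨ (a ∧ b) = a]; joining with the idempotent [a ∨ b] on the left leaves this value
    unchanged. *)
Lemma pre_ge_join a b : S a -> S b -> pre_ge L a b -> a ∨ b ∨ a = a.
Proof.
rewrite /pre_ge => Sa Sb bab; have Sab := smeet_closed Sa Sb.
have bp : b ∨ (a ∧ b) = a ∧ b.
  by rewrite -{1}bab -smeetA // sjoinIK.
have abp : a ∨ b ∨ (a ∧ b) = a by rewrite -sjoinA // bp sjoinKI.
have SU := sjoin_closed Sa Sb.
by rewrite -{2}abp sjoinA // sjoinxx.
Qed.

Lemma pre_ge_joinl a b : S a -> S b -> pre_ge L a b -> (a ∨ b) ∧ a = a ∨ b.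
Proof.
move=> Sa Sb /(pre_ge_join Sa Sb) aba; have SU := sjoin_closed Sa Sb.
by rewrite -{2}aba smeetKU.
Qed.

Lemma pre_ge_joinr a b : S a -> S b -> pre_ge L a b -> a ∧ (b ∨ a) = b ∨ a.
Proof.
move=> Sa Sb /(pre_ge_join Sa Sb) aba; have SU := sjoin_closed Sb Sa.
by rewrite -{1}aba -sjoinA // smeetUK.
Qed.

Lemma relD_sym x y : relD L x y -> relD L y x.
Proof. by case. Qed.

Lemma relD_trans x y z : S x -> S y -> S z ->
  relD L x y -> relD L y z -> relD L x z.
Proof.
move=> Sx Sy Sz [xy yx] [yz zy]; split.
  exact: (band_pre_ge_trans smeet_closed smeetA smeetxx Sx Sy Sz).
exact: (band_pre_ge_trans smeet_closed smeetA smeetxx Sz Sy Sx).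
Qed.

(** D-classes are rectangular bands; [y] and [z] are compared by transitivity through [x]. *)
Lemma relD_mulKm x y z : S x -> S y -> S z -> relD L x y -> relD L x z ->
  x ∧ y ∧ z = x ∧ z.
Proof.
move=> Sx Sy Sz Dxy Dxz.
have [zy yz] := relD_trans Sy Sx Sz (relD_sym Dxy) Dxz.
case: Dxy Dxz => xy yx [xz zx].
exact: (rectangular_mulKm smeet_closed smeetA smeetxx).
Qed.

(* [a ∨ b] lies in the class of [a] and acts as a left identity on [b], so
   that [a ∧ a1 ∧ b] can be computed in the rectangular band of [a]. *)
Lemma relD_absorbl a a1 b : S a -> S a1 -> S b -> relD L a a1 ->
  pre_ge L a b -> a ∧ a1 ∧ b = a ∧ b.
Proof.
move=> Sa Sa1 Sb Da ab; have SU := sjoin_closed Sa Sb.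
have SI := smeet_closed Sa Sa1.
have DU : relD L a (a ∨ b).
  by split; rewrite /pre_ge ?smeetKU ?smeetxx // pre_ge_joinl // smeetxx.
have Ub : (a ∨ b) ∧ b = b by rewrite smeetUK.
move: (a ∨ b) SU DU Ub => e Se De eb.
by rewrite -eb smeetA // (relD_mulKm Sa Sa1 Se) // smeetA.
Qed.

Lemma relD_absorbr a a1 b : S a -> S a1 -> S b -> relD L a a1 ->
  pre_ge L a b -> b ∧ (a1 ∧ a) = b ∧ a.
Proof.
move=> Sa Sa1 Sb Da ab; have SU := sjoin_closed Sb Sa.
have SI := smeet_closed Sa1 Sa.
have aU : a ∧ (b ∨ a) = b ∨ a by rewrite pre_ge_joinr.
have DU : relD L (b ∨ a) a.
  split; rewrite /pre_ge.
    by rewrite aU smeetUK.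
  by rewrite smeetUK // aU.
have DU1 := relD_trans SU Sa Sa1 DU Da.
have bU : b ∧ (b ∨ a) = b by rewrite smeetKU.
move: (b ∨ a) SU {aU} DU DU1 bU => e Se De De1 be.
by rewrite -be -smeetA // [e ∧ _]smeetA // (relD_mulKm Se Sa1 Sa) // smeetA.
Qed.

(** Being below [a], [b] equals [a ∧ b ∧ a], where the copies of [a] absorb [a1] and [a2]. The
    resulting value depends on [a] and [b0] alone. *)
Lemma coset_elt_below a a1 a2 b b0 : S a -> S a1 -> S a2 -> S b0 ->
  relD L a a1 -> relD L a a2 -> pre_ge L a b0 -> nord_ge L a b ->
  b = a1 ∧ b0 ∧ a2 -> b = a ∧ b0 ∧ a.
Proof.
move=> Sa Sa1 Sa2 Sb0 D1 D2 ab0 [ab ba] bE.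
have {ab ba} -> : b = a ∧ b ∧ a by rewrite ab ba.
have S10 := smeet_closed Sa1 Sb0; have Sa0 := smeet_closed Sa Sb0.
have S2a := smeet_closed Sa2 Sa.
rewrite bE smeetA // smeetA // (relD_absorbl Sa Sa1 Sb0) //.
by rewrite -smeetA // -smeetA // (relD_absorbr Sa Sa2 Sb0) // smeetA.
Qed.

(** The hypotheses on [A] and [B] are spelled out in place of [Dclass_gt], so that the lemma applies
    to [dual_ops] without identifying the D-classes there. *)
Lemma meet_cosets_distinct (A B : set T) a b b' :
  A `<=` S -> B `<=` S -> A a -> B b -> B b' ->
  (forall x, A x -> relD L a x) -> (forall y, B y -> pre_ge L a y) ->
  nord_ge L a b -> nord_ge L a b' -> b <> b' ->
  in_distinct_cosets (cosets_in_lower L A B) b b'.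
Proof.
move=> sA sB Aa Bb Bb' DA aB ab ab' neq; split.
- exists (meet_coset L A b); first by exists b.
  by exists a, a; split=> //; case: ab => -> ->.
- exists (meet_coset L A b'); first by exists b'.
  by exists a, a; split=> //; case: ab' => -> ->.
(* If the two cosets coincide, [b] and [b'] both lie in the coset of [b0], so both equal
   [a ∧ b0 ∧ a]. *)
move=> _ _ [b0 Bb0 ->] [b1 Bb1 ->] [x [y [Ax Ay bE]]] Yb' XY.
move: Yb'; rewrite -XY => -[x' [y' [Ax' Ay' b'E]]]; apply: neq.
have coset_eltE := coset_elt_below (sA _ Aa) _ _ (sB _ Bb0) _ _ (aB _ Bb0).
rewrite (coset_eltE x y b _ _ _ _ ab bE); try by auto.
by rewrite -(coset_eltE x' y' b' _ _ _ _ ab' b'E); auto.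
Qed.

Lemma Dclass_sub A : is_Dclass L A -> A `<=` S.
Proof. by case=> x _ -> y []. Qed.

Lemma Dclass_relD A x y : is_Dclass L A -> A x -> A y -> relD L x y.
Proof.
case=> z Sz -> [Sx zx] [Sy zy].
exact: relD_trans Sx Sz Sy (relD_sym zx) zy.
Qed.

(** By definition of the order on classes [a ∧ b] is D-related to [b], and [b ∧ (a ∧ b) ∧ b = b]
    collapses to [b ∧ a ∧ b = b]. *)
Lemma Dclass_gt_pre_ge A B a b : Dclass_gt L A B -> A a -> B b -> pre_ge L a b.
Proof.
move=> [DA DB _ AB] Aa Bb.
have Sa := Dclass_sub DA Aa; have Sb := Dclass_sub DB Bb.
have Sba := smeet_closed Sb Sa.
have [+ _] := Dclass_relD DB (AB _ _ Aa Bb) Bb.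
by rewrite /pre_ge smeetA // -smeetA // smeetxx.
Qed.

Lemma pre_ge_dual a b : S a -> S b -> pre_ge L a b -> pre_ge (dual_ops L) b a.
Proof. exact: pre_ge_join. Qed.

Lemma nord_ge_dual a b : S a -> S b -> nord_ge L a b -> nord_ge (dual_ops L) b a.
Proof.
move=> Sa Sb [ab ba]; split=> /=.
  by rewrite -{1}ba sjoinIK.
by rewrite -{1}ab sjoinKI.
Qed.

End SkewLattice.

Lemma interval_distinct_cosets (T : Type) (L : skew_ops T) (A B C : set T)
    (a b b' c : T) :
  is_skew_lattice L -> Dclass_gt L A B -> Dclass_gt L B C ->
  A a -> B b -> B b' -> C c ->
  nord_ge L a b -> nord_ge L a b' -> nord_ge L b c -> nord_ge L b' c ->
  b <> b' ->
  in_distinct_cosets (cosets_in_lower L A B) b b' /\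
  in_distinct_cosets (cosets_in_upper L B C) b b'.
Proof.
move=> slL AB BC Aa Bb Bb' Cc ab ab' bc b'c neq.
have [[DA DB _ _] [_ DC _ _]] := (AB, BC).
have [[sA sB] sC] := (Dclass_sub DA, Dclass_sub DB, Dclass_sub DC).
split.
  apply: (meet_cosets_distinct slL sA sB Aa) => //.
  - by move=> x; apply: Dclass_relD.
  - by move=> y; apply: Dclass_gt_pre_ge AB Aa.
(* Cosets of [C] in [B] are, by unfolding, the lower cosets for [dual_ops L] with [C] as the upper
   class and [c] above [b] and [b']. *)
apply: (meet_cosets_distinct (dual_skew_lattice slL) sC sB Cc) => //=.
- move=> x Cx; have [cx xc] := Dclass_relD slL DC Cc Cx.
  by split; apply: pre_ge_dual => //; apply: sC.
- move=> y By; apply: pre_ge_dual => //; [exact: sB|exact: sC|].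
  exact: Dclass_gt_pre_ge BC By Cc.
- by apply: nord_ge_dual => //; [exact: sB|exact: sC].
- by apply: nord_ge_dual => //; [exact: sB|exact: sC].
Qed.

(** * Products of matrices in block form *)

Section BlockProducts.
Variables (F : fieldType) (n1 n2 n3 n4 : nat).

Lemma blockB_mul_blockA (a14 : 'M[F]_(n1, n4)) (a24 : 'M[F]_(n2, n4))
    (a34 : 'M[F]_(n3, n4)) b13 b14 b23 b24 :
  blockB b13 b14 b23 b24 *m blockA a14 a24 a34 =
  blockB b13 (a14 + b13 *m a34) b23 (a24 + b23 *m a34).
Proof.
rewrite /blockB /blockA !(mul_col_mx, mul_row_col, mul_mx_row).
by rewrite ?(mul0mx, mulmx0, mul1mx, mulmx1, add_row_mx, addr0, add0r).
Qed.

Lemma blockC_mul_blockB (b13 : 'M[F]_(n1, n3)) (b14 : 'M[F]_(n1, n4))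
    (b23 : 'M[F]_(n2, n3)) (b24 : 'M[F]_(n2, n4)) c12 c13 c14 :
  blockC c12 c13 c14 *m blockB b13 b14 b23 b24 =
  blockC c12 (b13 + c12 *m b23) (b14 + c12 *m b24).
Proof.
rewrite /blockC /blockB !(mul_col_mx, mul_row_col, mul_mx_row).
by rewrite ?(mul0mx, mulmx0, mul1mx, mulmx1, add_row_mx, addr0, add0r).
Qed.

Lemma blockB_inj (b13 b13' : 'M[F]_(n1, n3)) (b14 b14' : 'M[F]_(n1, n4))
    (b23 b23' : 'M[F]_(n2, n3)) (b24 b24' : 'M[F]_(n2, n4)) :
  blockB b13 b14 b23 b24 = blockB b13' b14' b23' b24' ->
  [/\ b13 = b13', b14 = b14', b23 = b23' & b24 = b24'].
Proof.
case/eq_col_mx => /eq_row_mx[_ /eq_row_mx[_ /eq_row_mx[-> ->]]].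
by case/eq_col_mx => /eq_row_mx[_ /eq_row_mx[_ /eq_row_mx[-> ->]]].
Qed.

Lemma blockC_inj (c12 c12' : 'M[F]_(n1, n2)) (c13 c13' : 'M[F]_(n1, n3))
    (c14 c14' : 'M[F]_(n1, n4)) :
  blockC c12 c13 c14 = blockC c12' c13' c14' ->
  [/\ c12 = c12', c13 = c13' & c14 = c14'].
Proof.
by case/eq_col_mx => /eq_row_mx[_ /eq_row_mx[-> /eq_row_mx[-> ->]]].
Qed.

(** Each product keeps the block shape of its left factor, so the relations can be compared block by
    block; the components discarded below are trivial identities. *)
Lemma block_relations (a14 : 'M[F]_(n1, n4)) (a24 : 'M[F]_(n2, n4))
    (a34 : 'M[F]_(n3, n4)) b13 b14 b23 b24 c12 c13 c14 :
  blockB b13 b14 b23 b24 *m blockA a14 a24 a34 = blockB b13 b14 b23 b24 ->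
  blockC c12 c13 c14 *m blockB b13 b14 b23 b24 = blockC c12 c13 c14 ->
  [/\ a14 + b13 *m a34 = b14, a24 + b23 *m a34 = b24,
      b13 + c12 *m b23 = c13 & b14 + c12 *m b24 = c14].
Proof.
rewrite blockB_mul_blockA blockC_mul_blockB.
by move=> /blockB_inj[_ h1 _ h2] /blockC_inj[_ h3 h4].
Qed.

End BlockProducts.

(** * Transport of the structure along an injection compatible with the operations *)

Section Transport.
Variables (T1 T2 : Type) (L1 : skew_ops T1) (L2 : skew_ops T2) (f : T1 -> T2).
Hypothesis f_inj : injective f.
Hypothesis f_dom : sdom L2 = f @` sdom L1.
Hypothesis f_meet : forall x y, smeet L2 (f x) (f y) = f (smeet L1 x y).
Hypothesis f_join : forall x y, sjoin L2 (f x) (f y) = f (sjoin L1 x y).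

Lemma transport_skew_lattice : is_skew_lattice L1 -> is_skew_lattice L2.
Proof.
case=> cl As idem ab1 ab2; split; rewrite f_dom.
- move=> _ _ [x Sx <-] [y Sy <-]; rewrite f_meet f_join.
  by have [h1 h2] := cl x y Sx Sy; split; [exists (smeet L1 x y)|exists (sjoin L1 x y)].
- move=> _ _ _ [x Sx <-] [y Sy <-] [z Sz <-]; rewrite !(f_meet, f_join).
  by have [-> ->] := As x y z Sx Sy Sz.
- by move=> _ [x Sx <-]; rewrite f_meet f_join; have [-> ->] := idem x Sx.
- move=> _ _ [x Sx <-] [y Sy <-]; rewrite !(f_meet, f_join).
  by have [-> ->] := ab1 x y Sx Sy.
- move=> _ _ [x Sx <-] [y Sy <-]; rewrite !(f_meet, f_join).
  by have [-> ->] := ab2 x y Sx Sy.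
Qed.

Lemma transport_relD x y : relD L2 (f x) (f y) <-> relD L1 x y.
Proof.
rewrite /relD /pre_ge !f_meet; split=> [[/f_inj ? /f_inj ?] //|[-> ->] //].
Qed.

Lemma transport_nord_ge x y : nord_ge L2 (f x) (f y) <-> nord_ge L1 x y.
Proof.
rewrite /nord_ge !f_meet; split=> [[/f_inj ? /f_inj ?] //|[-> ->] //].
Qed.

Lemma transport_nord_gt x y : nord_gt L2 (f x) (f y) <-> nord_gt L1 x y.
Proof.
rewrite /nord_gt transport_nord_ge; split=> -[? ne]; split=> //.
  by move=> xy; apply: ne; rewrite xy.
by move/f_inj.
Qed.

Lemma transport_sdom x : sdom L2 (f x) <-> sdom L1 x.
Proof. by rewrite f_dom; split=> [[y Sy /f_inj <-]|Sx] //; exists x. Qed.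

Lemma transport_covers x y : covers L2 (f x) (f y) <-> covers L1 x y.
Proof.
have domE u := propext (transport_sdom u).
have gtE u v := propext (transport_nord_gt u v).
rewrite /covers !domE gtE; split=> -[Sx Sy xy nz].
  split=> // -[z [Sz xz zy]]; apply: nz; exists (f z).
  by rewrite domE !gtE.
(* An element strictly between [f x] and [f y] lies in the domain of [L2], hence is the image of
   some [z]. *)
split=> // -[w []]; rewrite {1}f_dom => -[z Sz <-].
by rewrite !gtE => xz zy; apply: nz; exists z.
Qed.

Lemma transport_admissible_diagram : admissible_diagram_iso L1 L2 f.
Proof.
split; last by move=> x y _ _; rewrite transport_covers transport_relD.
split; first by rewrite f_dom.
- by move=> x y _ _; apply: f_inj.
- by rewrite f_dom.
Qed.

End Transport.

(** * The four-element skew lattice: its D-classes and coset bijections in any copy *)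

Lemma four_relD x y : relD four_ops x y <->
  match x, y with
  | el1, el1 | el2, el2 | el3, el3 | el0, el0 | el2, el3 | el3, el2 => True
  | _, _ => False
  end.
Proof. by case: x; case: y; split=> // -[]. Qed.

Section FourCopy.
Variables (T : Type) (L : skew_ops T) (f : four -> T).
Hypothesis f_inj : injective f.
Hypothesis f_dom : sdom L = f @` [set: four].
Hypothesis f_meet : forall x y, smeet L (f x) (f y) = f (four_meet x y).
Hypothesis f_join : forall x y, sjoin L (f x) (f y) = f (four_join x y).

Local Notation top := [set f el1].
Local Notation mid := [set f el2; f el3].
Local Notation bot := [set f el0].

Let f_relD x y : relD L (f x) (f y) <-> relD four_ops x y.
Proof. exact: (transport_relD (L1 := four_ops)). Qed.

Lemma four_DclassE x : [set y | sdom L y /\ relD L (f x) y] =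
  match x with el1 => top | el0 => bot | _ => mid end.
Proof.
rewrite f_dom; apply/seteqP; split=> [_ [[y _ <-]]|y].
  by move=> /f_relD /four_relD; case: x; case: y => //= _; auto.
have fD z : relD four_ops x z -> y = f z ->
    ((f @` [set: four]) y /\ relD L (f x) y).
  by move=> xz ->; split; [exists z | apply/f_relD].
by case: x fD => fD /=; [|case|case|]; apply: fD.
Qed.

Lemma four_is_Dclass X : is_Dclass L X <-> [\/ X = top, X = mid | X = bot].
Proof.
split=> [[x]|].
  rewrite {1}f_dom => -[y _ <-] ->; rewrite four_DclassE.
  by case: y; constructor.
by case=> ->; [exists (f el1)|exists (f el2)|exists (f el0)];
  rewrite ?four_DclassE // f_dom; eexists.
Qed.

Lemma four_top_gt_mid : Dclass_gt L top mid.
Proof.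
split; try by apply/four_is_Dclass; constructor.
  move=> e; have : mid (f el2) by left.
  by rewrite -e => /f_inj.
by move=> _ _ -> [] ->; rewrite f_meet; [left|right].
Qed.

Lemma four_mid_gt_bot : Dclass_gt L mid bot.
Proof.
split; try by apply/four_is_Dclass; constructor.
  move=> e; have : mid (f el2) by left.
  by rewrite e => /f_inj.
by move=> _ _ [] -> ->; rewrite f_meet.
Qed.

Lemma four_Dclass_chain A B C : Dclass_gt L A B -> Dclass_gt L B C ->
  [/\ A = top, B = mid & C = bot].
Proof.
have gtE X Y : Dclass_gt L X Y -> [\/ X = top /\ Y = mid,
    X = top /\ Y = bot | X = mid /\ Y = bot].
  case=> /four_is_Dclass DX /four_is_Dclass DY ne mY.
  case: DX DY ne mY => -> [] -> // ne mY; try by constructor.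
  (* The remaining pairs run upwards; in each, some product of an element of [X] by one of [Y] falls
     outside [Y]. *)
  - by have := mY (f el2) (f el1) (or_introl erefl) erefl; rewrite f_meet => /f_inj.
  - by have := mY (f el0) (f el1) erefl erefl; rewrite f_meet => /f_inj.
  - by have := mY (f el0) (f el2) erefl (or_introl erefl);
      rewrite f_meet => -[] /f_inj.
have mid_top : mid <> top.
  move=> e; have : mid (f el2) by left.
  by rewrite e => /f_inj.
have bot_top : bot <> top.
  by move=> e; have : bot (f el0) by []; rewrite e => /f_inj.
have bot_mid : bot <> mid.
  by move=> e; have : bot (f el0) by []; rewrite e => -[] /f_inj.
by move=> /gtE [] [-> ->] /gtE [] [] // ? ->.
Qed.

(** All cosets between comparable classes of the four-element lattice are single points, so each of
    its coset bijections is a single pair. *)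
Lemma phi_singletons A B a b : join_coset L B a = [set a] ->
  meet_coset L A b = [set b] -> nord_ge L a b ->
  phi L A B a b = fun x y => x = a /\ y = b.
Proof.
move=> Ja Mb ab; apply/funext => x; apply/funext => y; apply/propext.
by rewrite /phi Ja Mb; split=> [[-> -> _]|[-> ->]].
Qed.

Lemma four_phi_top_mid b : mid b ->
  phi L top mid (f el1) b = fun x y => x = f el1 /\ y = b.
Proof.
move=> mb; apply: phi_singletons.
- apply/seteqP; split=> [_ [_ [_ [[]-> []-> ->]]]|_ ->] //; rewrite ?f_join //;
    try by rewrite f_join.
  by exists (f el2), (f el2); split; [left|left|rewrite !f_join].
- apply/seteqP; split=> [_ [_ [_ [-> -> ->]]]|_ ->].
    by case: mb => ->; rewrite !f_meet.
  by exists (f el1), (f el1); split=> //; case: mb => ->; rewrite !f_meet.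
- by case: mb => ->; split; rewrite f_meet.
Qed.

Lemma four_phi_mid_bot b : mid b ->
  phi L mid bot b (f el0) = fun x y => x = b /\ y = f el0.
Proof.
move=> mb; apply: phi_singletons.
- apply/seteqP; split=> [_ [_ [_ [-> -> ->]]]|_ ->].
    by case: mb => ->; rewrite !f_join.
  by exists (f el0), (f el0); split=> //; case: mb => ->; rewrite !f_join.
- apply/seteqP; split=> [_ [_ [_ [[]-> []-> ->]]]|_ ->]; try by rewrite !f_meet.
  by exists (f el2), (f el2); split; [left|left|rewrite !f_meet].
- by case: mb => ->; split; rewrite f_meet.
Qed.

Lemma four_phi_top_bot :
  phi L top bot (f el1) (f el0) = fun x y => x = f el1 /\ y = f el0.
Proof.
apply: phi_singletons.
- apply/seteqP; split=> [_ [_ [_ [-> -> ->]]]|_ ->]; first by rewrite !f_join.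
  by exists (f el0), (f el0); split=> //; rewrite !f_join.
- apply/seteqP; split=> [_ [_ [_ [-> -> ->]]]|_ ->]; first by rewrite !f_meet.
  by exists (f el1), (f el1); split=> //; rewrite !f_meet.
- by split; rewrite f_meet.
Qed.

(** The only chain of three classes is [top], [mid], [bot]. A nonempty composite forces both factors
    to share their middle element, and is then the single pair formed by [f el1] and [f el0], which
    is the coset bijection from [top] to [bot]. *)
Lemma four_categorical : categorical L.
Proof.
move=> A B C _ _ AB BC [a [b [Aa Bb ->]]] [b' [c [Bb' Cc ->]]].
have [AE BE CE] := four_Dclass_chain AB BC; subst A B C.
have aE : a = f el1 := Aa; have cE : c = f el0 := Cc.
rewrite aE cE four_phi_top_mid // four_phi_mid_bot //.
move=> [x [z [y [_ yb] [yb' _]]]]; have bb' : b = b' by rewrite -yb.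
exists (f el1), (f el0); split=> //.
rewrite four_phi_top_bot; apply/funext => u; apply/funext => v; apply/propext.
split=> [[w [-> _] [_ ->]]|[-> ->]] //.
by exists b.
Qed.

(* The coset bijections are the graphs {(1, 2)}, {(1, 3)} from the top class and
   {(2, 0)}, {(3, 0)} to the bottom one; {(1, 3)} and {(2, 0)} do not compose. *)
Lemma four_not_strictly_categorical : ~ strictly_categorical L.
Proof.
have m2 : mid (f el2) by left.
have m3 : mid (f el3) by right.
case=> _ /(_ _ _ _ _ _ four_top_gt_mid four_mid_gt_bot
  (ex_intro _ (f el1) (ex_intro _ (f el3) (And3 erefl m3 erefl)))
  (ex_intro _ (f el2) (ex_intro _ (f el0) (And3 m2 erefl erefl)))).
rewrite four_phi_top_mid // four_phi_mid_bot //.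
by case=> x [z [y [_ ->] [/f_inj]]].
Qed.

End FourCopy.

(** * The four matrices as a copy of the four-element skew lattice *)

Section Counterexample.
Variable F : fieldType.

Definition ex_elt (i : four) : 'M[F]_4 :=
  match i with el1 => exa F | el2 => exb F | el3 => exb' F | el0 => exc F end.

Lemma ex_elt_mul i j : ex_elt i * ex_elt j = ex_elt (four_meet i j).
Proof.
apply/matrixP => k l; rewrite mxE !big_ord_recl big_ord0.
by case: i; case: j; rewrite !mxE /=; case: k => [[|[|[|[|k]]]] //= _];
  case: l => [[|[|[|[|l]]]] //= _];
  rewrite ?(mul0r, mulr0, mul1r, addr0, add0r).
Qed.

(** The product of two of the matrices is always one of the two factors, so it cancels in
    [x + y - x y] and leaves the other one, which is their join. *)
Lemma ex_elt_circ i j : circ (ex_elt i) (ex_elt j) = ex_elt (four_join i j).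
Proof.
by rewrite /circ ex_elt_mul; case: i; case: j => /=; rewrite ?addrK // addrC addKr.
Qed.

Lemma ex_elt_nabla i j : nabla (ex_elt i) (ex_elt j) = ex_elt (four_join i j).
Proof.
by rewrite /nabla ex_elt_circ expr2 ex_elt_mul; case: (four_join i j).
Qed.

Lemma ex_elt_inj : injective ex_elt.
Proof.
have one_zero : (1 : F) <> 0 by apply/eqP; apply: oner_neq0.
have zero_one : (0 : F) <> 1 by move/esym.
(* Counting from zero, the entries at (1,1), (1,2), (2,2) are 1, 0, 1 for [exa], 1, 0, 0 for [exb],
   1, 1, 0 for [exb'] and 0, 0, 0 for [exc]; they separate the four matrices. *)
by move=> i j /matrixP e; case: i j e => -[] // e;
  have := e (inord 1) (inord 1); have := e (inord 1) (inord 2);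
  have := e (inord 2) (inord 2); rewrite !mxE !inordK.
Qed.

Lemma exSetE : exSet F = ex_elt @` [set: four].
Proof.
apply/seteqP; split=> [x [[[]|]|] ->|_ [[] _ <-]].
- by exists el1.
- by exists el2.
- by exists el3.
- by exists el0.
- by left; left; left.
- by left; left; right.
- by left; right.
- by right.
Qed.

Lemma exSet_skew_lattice : skew_lattice_in_ring (exSet F).
Proof.
split; first by rewrite exSetE => _ [i _ <-]; rewrite ex_elt_mul; case: i.
by apply: (@transport_skew_lattice _ _ four_ops (ring_ops (exSet F)) ex_elt);
  [exact: exSetE|exact: ex_elt_mul|exact: ex_elt_nabla|exact: four_skew_lattice].
Qed.

Let block_simp := (@col_mxEu, @col_mxEd, @row_mxEl, @row_mxEr).

(** Presents the indices as nested shifts, the form on which [block_simp] selects a block. *)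
Lemma ord4P (i : 'I_(1 + (1 + (1 + 1)))) :
  [\/ i = lshift _ ord0, i = rshift 1 (lshift _ ord0),
      i = rshift 1 (rshift 1 (lshift 1 ord0)) |
      i = rshift 1 (rshift 1 (rshift 1 ord0))].
Proof.
have [{}i ->|{}i ->] := split_ordP i; first by rewrite [i]ord1; constructor.
have [{}i ->|{}i ->] := split_ordP i; first by rewrite [i]ord1; constructor.
by have [{}i ->|{}i ->] := split_ordP i; rewrite [i]ord1; constructor.
Qed.

(* The index type is written [1 + (1 + (1 + 1))], convertible to [4], because the
   block entry lemmas only match that form. *)
Lemma exaE : exa F = @blockA F 1 1 1 1 0 0 0.
Proof.
apply/(@matrixP F (1 + (1 + (1 + 1))) (1 + (1 + (1 + 1)))) => i j.
rewrite [LHS]mxE /blockA.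
by have [] := ord4P i => ->; have [] := ord4P j => ->; rewrite ?block_simp ?mxE.
Qed.

Lemma exbE : exb F = @blockB F 1 1 1 1 0 0 0 0.
Proof.
apply/(@matrixP F (1 + (1 + (1 + 1))) (1 + (1 + (1 + 1)))) => i j.
rewrite [LHS]mxE /blockB.
by have [] := ord4P i => ->; have [] := ord4P j => ->; rewrite ?block_simp ?mxE.
Qed.

Lemma exb'E : exb' F = @blockB F 1 1 1 1 0 0 1%:M 0.
Proof.
apply/(@matrixP F (1 + (1 + (1 + 1))) (1 + (1 + (1 + 1)))) => i j.
rewrite [LHS]mxE /blockB.
by have [] := ord4P i => ->; have [] := ord4P j => ->; rewrite ?block_simp ?mxE.
Qed.

Lemma excE : exc F = @blockC F 1 1 1 1 0 0 0.
Proof.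
apply/(@matrixP F (1 + (1 + (1 + 1))) (1 + (1 + (1 + 1)))) => i j.
rewrite [LHS]mxE /blockC.
by have [] := ord4P i => ->; have [] := ord4P j => ->; rewrite ?block_simp ?mxE.
Qed.

End Counterexample.

Theorem mainTheorem3 :
  (* not all skew lattices in rings are strictly categorical *)
  ~ (forall (R : pzRingType) (S : set R),
       skew_lattice_in_ring S -> strictly_categorical (ring_ops S)) /\
  (* a > b, b' > c forces b = b' or distinct cosets *)
  (forall (T : Type) (L : skew_ops T) (A B C : set T) (a b b' c : T),
     is_skew_lattice L -> Dclass_gt L A B -> Dclass_gt L B C ->
     A a -> B b -> B b' -> C c ->
     nord_gt L a b -> nord_gt L a b' -> nord_gt L b c -> nord_gt L b' c ->
     b = b' \/
     (in_distinct_cosets (cosets_in_lower L A B) b b' /\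
      in_distinct_cosets (cosets_in_upper L B C) b b')) /\
  (* the block equations *)
  (forall (F : fieldType) (n1 n2 n3 n4 : nat)
     (a14 : 'M[F]_(n1, n4)) (a24 : 'M[F]_(n2, n4)) (a34 : 'M[F]_(n3, n4))
     (b13 b13' : 'M[F]_(n1, n3)) (b14 b14' : 'M[F]_(n1, n4))
     (b23 b23' : 'M[F]_(n2, n3)) (b24 b24' : 'M[F]_(n2, n4))
     (c12 : 'M[F]_(n1, n2)) (c13 : 'M[F]_(n1, n3)) (c14 : 'M[F]_(n1, n4)),
     let a := blockA a14 a24 a34 in
     let b := blockB b13 b14 b23 b24 in
     let b' := blockB b13' b14' b23' b24' in
     let c := blockC c12 c13 c14 in
     b *m a = b -> b' *m a = b' -> c *m b = c -> c *m b' = c ->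
     [/\ a14 + b13 *m a34 = b14, a24 + b23 *m a34 = b24,
         b13 + c12 *m b23 = c13 & b14 + c12 *m b24 = c14] /\
     [/\ a14 + b13' *m a34 = b14', a24 + b23' *m a34 = b24',
         b13' + c12 *m b23' = c13 & b14' + c12 *m b24' = c14]) /\
  (* the counterexample *)
  (forall F : fieldType,
     let a := exa F in let b := exb F in let b' := exb' F in let c := exc F in
     let S := exSet F in
     let L := ring_ops S in
     (b * b' = b' /\ b' * b = b) /\
     [/\ b * a = b, b' * a = b', c * b = c & c * b' = c] /\
     (* block entries of the example, all blocks being of size 1 *)
     [/\ a = @blockA F 1 1 1 1 0 0 0,
         b = @blockB F 1 1 1 1 0 0 0 0,
         b' = @blockB F 1 1 1 1 0 0 1%:M 0 &
         c = @blockC F 1 1 1 1 0 0 0] /\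
     skew_lattice_in_ring S /\
     (exists f : four -> 'M[F]_4,
        admissible_diagram_iso four_ops L f /\
        [/\ f el1 = a, f el2 = b, f el3 = b' & f el0 = c]) /\
     (forall X : set 'M[F]_4,
        is_Dclass L X <-> [\/ X = [set a], X = [set b; b'] | X = [set c]]) /\
     Dclass_gt L [set a] [set b; b'] /\ Dclass_gt L [set b; b'] [set c] /\
     [/\ nord_gt L a b, nord_gt L b c, nord_gt L a b' & nord_gt L b' c] /\
     b <> b' /\
     categorical L /\ ~ strictly_categorical L).
Proof.
have notSC (F : fieldType) : ~ strictly_categorical (ring_ops (exSet F)).
  apply: (@four_not_strictly_categorical _ _ (@ex_elt F)).
  - exact: ex_elt_inj.
  - exact: exSetE.
  - exact: ex_elt_mul.
  - exact: ex_elt_nabla.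
split; [|split; [|split]].
(* The example works over every field; [rat] supplies a concrete one. *)
- by move/(_ _ _ (exSet_skew_lattice rat))/notSC.
- move=> T L A B C a b b' c slL AB BC Aa Bb Bb' Cc [ab _] [ab' _] [bc _] [b'c _].
  have [->|neq] := EM (b = b'); [by left|right].
  exact: interval_distinct_cosets slL AB BC Aa Bb Bb' Cc ab ab' bc b'c neq.
- move=> F n1 n2 n3 n4 a14 a24 a34 b13 b13' b14 b14' b23 b23' b24 b24' c12 c13 c14.
  by move=> /= ba b'a cb cb'; split; [apply: block_relations ba cb
                                     |apply: block_relations b'a cb'].
move=> F /=.
(* With the four matrices named as values of [f], the remaining claims become instances of facts
   about copies of [four_ops]. *)
pose f := @ex_elt F.
have f_inj : injective f by exact: ex_elt_inj.
have f_dom : sdom (ring_ops (exSet F)) = f @` [set: four] by exact: exSetE.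
have f_meet x y : smeet (ring_ops (exSet F)) (f x) (f y) = f (four_meet x y).
  exact: ex_elt_mul.
have f_join x y : sjoin (ring_ops (exSet F)) (f x) (f y) = f (four_join x y).
  exact: ex_elt_nabla.
have gtE x y : nord_gt (ring_ops (exSet F)) (f x) (f y) <-> nord_gt four_ops x y.
  exact: transport_nord_gt.
split; first by split; [exact: (f_meet el2 el3)|exact: (f_meet el3 el2)].
split.
  by split; [exact: (f_meet el2 el1)|exact: (f_meet el3 el1)
            |exact: (f_meet el0 el2)|exact: (f_meet el0 el3)].
split; first by split; [exact: exaE|exact: exbE|exact: exb'E|exact: excE].
split; first exact: exSet_skew_lattice.
split; first by exists f; split=> //; apply: transport_admissible_diagram.
split; first by move=> X; apply: (four_is_Dclass f_inj f_dom f_meet).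
split; first exact: (four_top_gt_mid f_inj f_dom f_meet).
split; first exact: (four_mid_gt_bot f_inj f_dom f_meet).
split.
  by split; [apply/(gtE el1 el2)|apply/(gtE el2 el0)
            |apply/(gtE el1 el3)|apply/(gtE el3 el0)].
split; first by move=> /(f_inj el2 el3).
split; last exact: notSC.
exact: (four_categorical f_inj f_dom f_meet f_join).
Qed.
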